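(* Let $A$ be a bounded pseudo-hoop and let $F$ be a normal filter of $A$. Then $F$ is an involutive filter of $A$ if and only if the quotient $A/F$ is an involutive pseudo-hoop.
   Context: A pseudo-hoop is an algebra $(A,\odot,\rightarrow,\rightsquigarrow,1)$ of type $(2,2,2,0)$ such that for all $x,y,z\in A$: $x\odot 1=1\odot x=x$; $x\rightarrow x=x\rightsquigarrow x=1$; $(x\odot y)\rightarrow z=x\rightarrow(y\rightarrow z)$; $(x\odot y)\rightsquigarrow z=y\rightsquigarrow(x\rightsquigarrow z)$; $(x\rightarrow y)\odot x=(y\rightarrow x)\odot y=x\odot(x\rightsquigarrow y)=y\odot(y\rightsquigarrow x)$. The order is $x\le y$ iff $x\rightarrow y=1$. It is bounded if it has a least element $0$; then $x^-=x\rightarrow 0$, $x^\sim=x\rightsquigarrow 0$, $x^{-\sim}=(x^-)^\sim$, $x^{\sim-}=(x^\sim)^-$. A bounded pseudo-hoop is involutive if $x^{-\sim}=x^{\sim-}=x$ for all $x$. A filter is a nonempty $F\subseteq A$ closed under $\odot$ and upward closed; it is normal if for all $x,y$: $x\rightarrow y\in F$ iff $x\rightsquigarrow y\in F$; it is involutive if $x^{-\sim}\rightarrow x\in F$ and $x^{\sim-}\rightsquigarrow x\in F$ for all $x$. For a normal filter $F$, the relation $\Theta_F$ given by $(x,y)\in\Theta_F$ iff $x\rightarrow y\in F$ and $y\rightarrow x\in F$ is a congruence of $A$, and $A/F$ denotes the quotient pseudo-hoop $A/\Theta_F$ (bounded with least element the class of $0$). *)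

(* Defs.v *)
From HB Require Import structures.
From mathcomp Require Import all_boot.
From mathcomp Require Import boolp classical_sets.

Set Implicit Arguments.
Unset Strict Implicit.
Unset Printing Implicit Defensive.

Declare Scope pseudo_hoop_scope.
Delimit Scope pseudo_hoop_scope with PH.
Local Open Scope classical_set_scope.
Local Open Scope quotient_scope.
Local Open Scope pseudo_hoop_scope.

Reserved Notation "x ⊙ y" (at level 40, left associativity).
Reserved Notation "x → y" (at level 55, right associativity).
Reserved Notation "x ⇝ y" (at level 55, right associativity).
Reserved Notation "x ≼ y" (at level 70, no associativity).

(* The choiceType structure is only there to form quotients with
   generic_quotient; boolp provides it classically for every type. *)
HB.mixin Record isPseudoHoop A of Choice A := {
  ph_one : A;
  ph_mul : A -> A -> A;
  ph_limp : A -> A -> A;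
  ph_rimp : A -> A -> A;
  ph_mulx1 : forall x, ph_mul x ph_one = x;
  ph_mul1x : forall x, ph_mul ph_one x = x;
  ph_limpxx : forall x, ph_limp x x = ph_one;
  ph_rimpxx : forall x, ph_rimp x x = ph_one;
  ph_limpM : forall x y z, ph_limp (ph_mul x y) z = ph_limp x (ph_limp y z);
  ph_rimpM : forall x y z, ph_rimp (ph_mul x y) z = ph_rimp y (ph_rimp x z);
  ph_limpC : forall x y, ph_mul (ph_limp x y) x = ph_mul (ph_limp y x) y;
  ph_limp_rimp : forall x y, ph_mul (ph_limp y x) y = ph_mul x (ph_rimp x y);
  ph_rimpC : forall x y, ph_mul x (ph_rimp x y) = ph_mul y (ph_rimp y x)
}.

#[short(type="pseudoHoopType")]
HB.structure Definition PseudoHoop := {A of isPseudoHoop A & Choice A}.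

Notation "x ⊙ y" := (ph_mul x y) : pseudo_hoop_scope.
Notation "x → y" := (ph_limp x y) : pseudo_hoop_scope.
Notation "x ⇝ y" := (ph_rimp x y) : pseudo_hoop_scope.
Notation "1" := ph_one : pseudo_hoop_scope.

Definition ph_le (A : pseudoHoopType) (x y : A) : Prop := x → y = 1.
Notation "x ≼ y" := (ph_le x y) : pseudo_hoop_scope.

HB.mixin Record PseudoHoop_isBounded A of PseudoHoop A := {
  ph_zero : A;
  ph_le0x : forall x : A, ph_zero ≼ x
}.

#[short(type="boundedPseudoHoopType")]
HB.structure Definition BoundedPseudoHoop :=
  {A of PseudoHoop_isBounded A & PseudoHoop A}.

Notation "0" := ph_zero : pseudo_hoop_scope.

(* x^- and x^~ respectively *)
Definition ph_lneg (A : boundedPseudoHoopType) (x : A) : A := x → 0.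
Definition ph_rneg (A : boundedPseudoHoopType) (x : A) : A := x ⇝ 0.

Definition involutive_pseudo_hoop (A : boundedPseudoHoopType) : Prop :=
  forall x : A, ph_rneg (ph_lneg x) = x /\ ph_lneg (ph_rneg x) = x.

Definition ph_filter (A : pseudoHoopType) (F : set A) : Prop :=
  [/\ F !=set0,
      forall x y, F x -> F y -> F (x ⊙ y) &
      forall x y, F x -> x ≼ y -> F y].

Definition normal_filter (A : pseudoHoopType) (F : set A) : Prop :=
  ph_filter F /\ forall x y, F (x → y) <-> F (x ⇝ y).

Definition involutive_filter (A : boundedPseudoHoopType) (F : set A) : Prop :=
  ph_filter F /\
  forall x, F (ph_rneg (ph_lneg x) → x) /\ F (ph_lneg (ph_rneg x) ⇝ x).

Section PseudoHoopTheory.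
Variable A : pseudoHoopType.
Implicit Types x y z w : A.

Lemma ph_le_anti x y : x ≼ y -> y ≼ x -> x = y.
Proof.
by rewrite /ph_le => xy yx; have := ph_limpC x y; rewrite xy yx !ph_mul1x.
Qed.

Lemma ph_le_refl x : x ≼ x. Proof. exact: ph_limpxx. Qed.

Lemma ph_limp1x x : 1 → x = x.
Proof.
apply: ph_le_anti; rewrite /ph_le.
  by rewrite -{1}[1 → x]ph_mulx1 ph_limpM ph_limpxx.
by rewrite -ph_limpM ph_mulx1 ph_limpxx.
Qed.

Lemma ph_lex1 x : x ≼ 1.
Proof.
rewrite /ph_le -{1}[x](_ : (x → 1) ⊙ x = x) ?ph_limpM ?ph_limpxx //.
by rewrite ph_limpC ph_mulx1 ph_limp1x.
Qed.

Lemma ph_rimp_le x y : x ≼ y <-> x ⇝ y = 1.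
Proof.
have lr : (x → y) ⊙ x = x ⊙ (x ⇝ y) by rewrite ph_limpC ph_limp_rimp.
rewrite /ph_le; split=> h.
  by rewrite -{1}[x]ph_mul1x -h lr ph_rimpM ph_rimpxx.
by rewrite -{1}[x]ph_mulx1 -h -lr ph_limpM ph_limpxx.
Qed.

Lemma ph_mulA x y z : x ⊙ (y ⊙ z) = x ⊙ y ⊙ z.
Proof.
have mulA w : (x ⊙ (y ⊙ z)) → w = (x ⊙ y ⊙ z) → w by rewrite !ph_limpM.
by apply: ph_le_anti; rewrite /ph_le ?mulA ?ph_limpxx -?mulA ?ph_limpxx.
Qed.

Lemma ph_le_trans y x z : x ≼ y -> y ≼ z -> x ≼ z.
Proof.
rewrite {1 2}/ph_le => xy yz.
have -> : x = (y → x) ⊙ y by rewrite -ph_limpC xy ph_mul1x.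
by rewrite /ph_le ph_limpM yz; apply: ph_lex1.
Qed.

Lemma ph_limp_adj x y z : x ⊙ y ≼ z <-> x ≼ (y → z).
Proof. by rewrite /ph_le ph_limpM. Qed.

Lemma ph_rimp_adj x y z : x ⊙ y ≼ z <-> y ≼ (x ⇝ z).
Proof. by rewrite !ph_rimp_le ph_rimpM. Qed.

Lemma ph_mulS x y z : y ≼ z -> x ⊙ y ≼ x ⊙ z.
Proof.
move=> yz; apply/ph_rimp_adj; apply: ph_le_trans yz _.
by apply/ph_rimp_adj; apply: ph_le_refl.
Qed.

Lemma ph_mulSl x y z : y ≼ z -> y ⊙ x ≼ z ⊙ x.
Proof.
move=> yz; apply/ph_limp_adj; apply: ph_le_trans yz _.
by apply/ph_limp_adj; apply: ph_le_refl.
Qed.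

Lemma ph_limp_app x y : (x → y) ⊙ x ≼ y.
Proof. by apply/ph_limp_adj; apply: ph_le_refl. Qed.

Lemma ph_rimp_app x y : x ⊙ (x ⇝ y) ≼ y.
Proof. by apply/ph_rimp_adj; apply: ph_le_refl. Qed.

Lemma ph_limp_trans x y z : (y → z) ⊙ (x → y) ≼ (x → z).
Proof.
apply: (proj1 (ph_limp_adj _ _ _)); rewrite -ph_mulA.
by apply: ph_le_trans (ph_limp_app y z); apply/ph_mulS/ph_limp_app.
Qed.

Lemma ph_rimp_trans x y z : (x ⇝ y) ⊙ (y ⇝ z) ≼ (x ⇝ z).
Proof.
apply: (proj1 (ph_rimp_adj _ _ _)); rewrite ph_mulA.
by apply: ph_le_trans (ph_rimp_app y z); apply/ph_mulSl/ph_rimp_app.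
Qed.

Lemma ph_limp_mulr x y z : (x → y) ≼ (x ⊙ z → y ⊙ z).
Proof. by apply/ph_limp_adj; rewrite ph_mulA; apply/ph_mulSl/ph_limp_app. Qed.

Lemma ph_rimp_mull x y z : (x ⇝ y) ≼ (z ⊙ x ⇝ z ⊙ y).
Proof. by apply/ph_rimp_adj; rewrite -ph_mulA; apply/ph_mulS/ph_rimp_app. Qed.

End PseudoHoopTheory.

Definition theta (A : pseudoHoopType) (F : set A) (x y : A) : Prop :=
  F (x → y) /\ F (y → x).

Section Quotient.
Variables (A : pseudoHoopType) (F : set A) (nF : normal_filter F).
Implicit Types x y z : A.

Let F_mul x y : F x -> F y -> F (x ⊙ y).
Proof. by case: nF => -[_ + _] _; apply. Qed.

Let F_up x y : F x -> x ≼ y -> F y.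
Proof. by case: nF => -[_ _ +] _; apply. Qed.

Let F_lr x y : F (x → y) <-> F (x ⇝ y).
Proof. by case: nF. Qed.

Let F1 : F 1.
Proof. by case: nF => -[[x Fx] _ _] _; apply: F_up Fx (ph_lex1 x). Qed.

Lemma theta_refl x : theta F x x.
Proof. by rewrite /theta ph_limpxx. Qed.

Lemma theta_sym x y : theta F x y -> theta F y x.
Proof. by case. Qed.

Lemma theta_trans y x z : theta F x y -> theta F y z -> theta F x z.
Proof.
move=> [xy yx] [yz zy]; split.
  exact: F_up (F_mul yz xy) (ph_limp_trans x y z).
exact: F_up (F_mul yx zy) (ph_limp_trans z y x).
Qed.

Lemma theta_mul x x' y y' :
  theta F x x' -> theta F y y' -> theta F (x ⊙ y) (x' ⊙ y').
Proof.
move=> [xx' x'x] [/F_lr yy' /F_lr y'y]; apply: (@theta_trans (x' ⊙ y)).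
  by split; [apply: F_up xx' _ | apply: F_up x'x _]; apply: ph_limp_mulr.
by split; apply/F_lr; [apply: F_up yy' _ | apply: F_up y'y _];
  apply: ph_rimp_mull.
Qed.

Lemma theta_limp x x' y y' :
  theta F x x' -> theta F y y' -> theta F (x → y) (x' → y').
Proof.
move=> [xx' x'x] [yy' y'y]; apply: (@theta_trans (x' → y)).
  by split; apply/F_lr; [apply: F_up x'x _ | apply: F_up xx' _];
    apply/ph_rimp_adj/ph_limp_trans.
by split; [apply: F_up yy' _ | apply: F_up y'y _];
  apply/ph_limp_adj/ph_limp_trans.
Qed.

Lemma theta_rimp x x' y y' :
  theta F x x' -> theta F y y' -> theta F (x ⇝ y) (x' ⇝ y').
Proof.
move=> [/F_lr xx' /F_lr x'x] [/F_lr yy' /F_lr y'y].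
apply: (@theta_trans (x' ⇝ y)).
  by split; [apply: F_up x'x _ | apply: F_up xx' _];
    apply/ph_limp_adj/ph_rimp_trans.
by split; apply/F_lr; [apply: F_up yy' _ | apply: F_up y'y _];
  apply/ph_rimp_adj/ph_rimp_trans.
Qed.

(* nF is an argument so that the equivalence proof can be attached to the
   relation. *)
Definition theta_rel of normal_filter F : rel A := fun x y => `[< theta F x y >].

Lemma theta_rel_is_equiv : equiv_class_of (theta_rel nF).
Proof.
split=> [x|x y|y x z]; first by apply/asboolP/theta_refl.
  by apply/asboolP/asboolP => /theta_sym.
by move=> /asboolP xy /asboolP yz; apply/asboolP; apply: theta_trans xy yz.
Qed.

Canonical theta_rel_equiv := EquivRelPack theta_rel_is_equiv.
Canonical theta_rel_encModRel := defaultEncModRel (theta_rel nF).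

Definition ph_quot := {eq_quot (theta_rel nF)}.

HB.instance Definition _ : EqQuotient A (theta_rel nF) ph_quot :=
  EqQuotient.on ph_quot.
HB.instance Definition _ := Choice.on ph_quot.

Lemma ph_quotP x y : \pi_ph_quot x = \pi_ph_quot y <-> theta F x y.
Proof. by split=> [/eqmodP/asboolP|h]; last by apply/eqmodP/asboolP. Qed.

Definition ph_quot_one : ph_quot := \pi_ph_quot 1.
Definition ph_quot_mul : ph_quot -> ph_quot -> ph_quot :=
  lift_op2 ph_quot (@ph_mul A).
Definition ph_quot_limp : ph_quot -> ph_quot -> ph_quot :=
  lift_op2 ph_quot (@ph_limp A).
Definition ph_quot_rimp : ph_quot -> ph_quot -> ph_quot :=
  lift_op2 ph_quot (@ph_rimp A).

Let theta_repr x : theta F x (repr (\pi_ph_quot x)).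
Proof. by apply/ph_quotP; rewrite reprK. Qed.

Let pi_mul x y : ph_quot_mul (\pi x) (\pi y) = \pi_ph_quot (x ⊙ y).
Proof.
by unlock ph_quot_mul; apply/ph_quotP/theta_sym/theta_mul; apply: theta_repr.
Qed.

Let pi_limp x y : ph_quot_limp (\pi x) (\pi y) = \pi_ph_quot (x → y).
Proof.
by unlock ph_quot_limp; apply/ph_quotP/theta_sym/theta_limp; apply: theta_repr.
Qed.

Let pi_rimp x y : ph_quot_rimp (\pi x) (\pi y) = \pi_ph_quot (x ⇝ y).
Proof.
by unlock ph_quot_rimp; apply/ph_quotP/theta_sym/theta_rimp; apply: theta_repr.
Qed.

Let pi_opE := (pi_mul, pi_limp, pi_rimp).

Fact ph_quot_mulx1 a : ph_quot_mul a ph_quot_one = a.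
Proof. by elim/quotW: a => x; rewrite pi_opE ph_mulx1. Qed.
Fact ph_quot_mul1x a : ph_quot_mul ph_quot_one a = a.
Proof. by elim/quotW: a => x; rewrite pi_opE ph_mul1x. Qed.
Fact ph_quot_limpxx a : ph_quot_limp a a = ph_quot_one.
Proof. by elim/quotW: a => x; rewrite pi_opE ph_limpxx. Qed.
Fact ph_quot_rimpxx a : ph_quot_rimp a a = ph_quot_one.
Proof. by elim/quotW: a => x; rewrite pi_opE ph_rimpxx. Qed.
Fact ph_quot_limpM a b c :
  ph_quot_limp (ph_quot_mul a b) c = ph_quot_limp a (ph_quot_limp b c).
Proof.
elim/quotW: a => x; elim/quotW: b => y; elim/quotW: c => z.
by rewrite !pi_opE ph_limpM.
Qed.
Fact ph_quot_rimpM a b c :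
  ph_quot_rimp (ph_quot_mul a b) c = ph_quot_rimp b (ph_quot_rimp a c).
Proof.
elim/quotW: a => x; elim/quotW: b => y; elim/quotW: c => z.
by rewrite !pi_opE ph_rimpM.
Qed.
Fact ph_quot_limpC a b :
  ph_quot_mul (ph_quot_limp a b) a = ph_quot_mul (ph_quot_limp b a) b.
Proof.
by elim/quotW: a => x; elim/quotW: b => y; rewrite !pi_opE ph_limpC.
Qed.
Fact ph_quot_limp_rimp a b :
  ph_quot_mul (ph_quot_limp b a) b = ph_quot_mul a (ph_quot_rimp a b).
Proof.
by elim/quotW: a => x; elim/quotW: b => y; rewrite !pi_opE ph_limp_rimp.
Qed.
Fact ph_quot_rimpC a b :
  ph_quot_mul a (ph_quot_rimp a b) = ph_quot_mul b (ph_quot_rimp b a).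
Proof.
by elim/quotW: a => x; elim/quotW: b => y; rewrite !pi_opE ph_rimpC.
Qed.

HB.instance Definition _ := isPseudoHoop.Build ph_quot
  ph_quot_mulx1 ph_quot_mul1x ph_quot_limpxx ph_quot_rimpxx
  ph_quot_limpM ph_quot_rimpM ph_quot_limpC ph_quot_limp_rimp ph_quot_rimpC.

Lemma ph_quot_pi1 : \pi_ph_quot 1 = 1. Proof. by []. Qed.
Lemma ph_quot_piM : {morph \pi_ph_quot : x y / x ⊙ y}.
Proof. by move=> x y; rewrite -pi_mul. Qed.
Lemma ph_quot_pi_limp : {morph \pi_ph_quot : x y / x → y}.
Proof. by move=> x y; rewrite -pi_limp. Qed.
Lemma ph_quot_pi_rimp : {morph \pi_ph_quot : x y / x ⇝ y}.
Proof. by move=> x y; rewrite -pi_rimp. Qed.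

End Quotient.

Section BoundedQuotient.
Variables (A : boundedPseudoHoopType) (F : set A) (nF : normal_filter F).

Fact ph_quot_le0x (a : ph_quot nF) : \pi_(ph_quot nF) 0 ≼ a.
Proof.
by elim/quotW: a => x; rewrite /ph_le -ph_quot_pi_limp ph_le0x.
Qed.

HB.instance Definition _ :=
  PseudoHoop_isBounded.Build (ph_quot nF) ph_quot_le0x.

End BoundedQuotient.

(* Main.v *)
Require Import Defs.
From mathcomp Require Import all_boot.
From mathcomp Require Import boolp classical_sets.

Local Open Scope classical_set_scope.
Local Open Scope quotient_scope.
Local Open Scope pseudo_hoop_scope.

(** Every [x] lies below both of its double negations, so in the quotient only the reverse
    inequalities are in question. Since the projection commutes with both negations,
    [ph_quot_pi_eq_le] turns each involution law at the class of [x] into membership in [F] of the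
    implication from the double negation back to [x]. *)

Lemma ph_le_rneg_lneg (A : boundedPseudoHoopType) (x : A) :
  x ≼ ph_rneg (ph_lneg x).
Proof. by apply/ph_rimp_adj; apply: ph_limp_app. Qed.

Lemma ph_le_lneg_rneg (A : boundedPseudoHoopType) (x : A) :
  x ≼ ph_lneg (ph_rneg x).
Proof. by apply/ph_limp_adj; apply: ph_rimp_app. Qed.

Section QuotientNegation.
Variables (A : boundedPseudoHoopType) (F : set A) (nF : normal_filter F).

Lemma ph_quot_pi_lneg : {morph \pi_(ph_quot nF) : x / ph_lneg x}.
Proof. by move=> x; rewrite [LHS]ph_quot_pi_limp. Qed.

Lemma ph_quot_pi_rneg : {morph \pi_(ph_quot nF) : x / ph_rneg x}.
Proof. by move=> x; rewrite [LHS]ph_quot_pi_rimp. Qed.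

(** Of the two implications in [theta], [x → y] is already [1], which lies in [F]. *)
Lemma ph_quot_pi_eq_le (x y : A) : x ≼ y ->
  \pi_(ph_quot nF) y = \pi_(ph_quot nF) x <-> F (y → x).
Proof.
move=> xy; split=> [/ph_quotP[]//|Fyx]; apply/ph_quotP; split=> //.
by rewrite [x → y]xy -(ph_limpxx x); case: (theta_refl nF x).
Qed.

End QuotientNegation.

Theorem theorem4p13 (A : boundedPseudoHoopType) (F : set A)
    (nF : normal_filter F) :
  involutive_filter F <-> involutive_pseudo_hoop (ph_quot nF).
Proof.
have [fF lr] := nF; split=> [[_ inv] a|inv].
  (* [theta] only involves [→], so normality ([lr]) converts the [⇝] condition. *)
  elim/quotW: a => x; have [Flr /lr Frl] := inv x.
  rewrite -!(ph_quot_pi_lneg, ph_quot_pi_rneg).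
  split.
    exact/(ph_quot_pi_eq_le _ _ nF _ _ (ph_le_rneg_lneg _ x)).
  exact/(ph_quot_pi_eq_le _ _ nF _ _ (ph_le_lneg_rneg _ x)).
split=> // x; have := inv (\pi_(ph_quot nF) x).
rewrite -!(ph_quot_pi_lneg, ph_quot_pi_rneg) => -[eq_lr eq_rl]; split.
  exact/(ph_quot_pi_eq_le _ _ nF _ _ (ph_le_rneg_lneg _ x)).
exact/lr/(ph_quot_pi_eq_le _ _ nF _ _ (ph_le_lneg_rneg _ x)).
Qed.
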